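(* Let $d\ge2$ and $\theta\in(0,1]$. There exist a probability measure $\tilde\rho$ on $[-1,1]^d$ satisfying, for some $M>0$, $\tilde\rho(B_\eta(x))\le M\eta^{d-1+\theta}$ for every $x\in\mathbb R^d$ and $\eta>0$, and families of probability measures $(\rho_\varepsilon)_{\varepsilon\in[0,1]},(\mu_\varepsilon)_{\varepsilon\in[0,1]}$ in $\mathcal P([-1,1]^d)$, such that for all $q\in[1,\infty)$, $r\in[1,\infty]$ and $\varepsilon\in[0,1]$, $$\operatorname{diam}_{W_q}\Gamma(\rho_\varepsilon,\mu_\varepsilon)\ge 8^{-1}\varepsilon^{\theta/q},\qquad\text{but}\qquad W_r(\rho_\varepsilon,\tilde\rho)\le\begin{cases}\varepsilon^{\frac{r+\theta}{r}}&r<\infty,\\ \varepsilon&r=\infty.\end{cases}$$ Consequently, for all $q\in[1,\infty)$, $r\in[1,\infty]$ and $\theta\in(0,1]$, putting $\nu=\frac{r\theta}{q(r+\theta)}$ if $r<\infty$ and $\nu=\frac\theta q$ if $r=\infty$, the exponent $\nu$ is optimal in the following two estimates (neither holds in general with an exponent $\alpha>\nu$ in place of $\nu$ and a finite constant $C$ that does not depend on the varying data), where $\mathcal X,\mathcal Y\subset\mathbb R^d$ are compact and convex and $\bar\rho\in\mathcal P(\mathcal X)$ satisfies $\bar\rho(B_\eta(x))\le M\eta^{d-1+\theta}$ for all $x\in\mathbb R^d$, $\eta>0$: (i) $\operatorname{diam}_{W_q}\Gamma(\rho,\mu)\le C\,W_r(\rho,\bar\rho)^{\nu}$ for all $\rho\in\mathcal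 P(\mathcal X)$, $\mu\in\mathcal P(\mathcal Y)$; (ii) $W_q\big((\mathrm{id},\nabla\phi)_\#\bar\rho,\gamma_1\big)\le C\,W_r(\bar\rho,\rho_1)^{\nu}$ for all convex $\phi:\mathbb R^d\to\mathbb R$ with $\partial\phi(\mathbb R^d)\subset\mathcal Y$ and all $\gamma_1\in\mathcal P(\mathcal X\times\mathcal Y)$ with first marginal $\rho_1$ and $\operatorname{spt}\gamma_1\subset\operatorname{graph}(\partial\phi)$.
   Context: $\mathcal P(E)$ is the set of Borel probability measures on $E$, and $B_\eta(x)$ is the open Euclidean ball. $\Pi(\rho,\mu)$ is the set of couplings of $\rho$ and $\mu$, and $\Gamma(\rho,\mu)$ is the set of minimisers of $\int\|x-y\|^2\,d\gamma(x,y)$ over $\gamma\in\Pi(\rho,\mu)$ (optimal plans). For $r\in[1,\infty]$ and measures on $\mathbb R^d$, $W_r(\rho,\mu)=\min_{\gamma\in\Pi(\rho,\mu)}\|x-y\|_{L^r(\gamma)}$. For probability measures $\gamma_0,\gamma_1$ on $\mathbb R^d\times\mathbb R^d$, $W_q^q(\gamma_0,\gamma_1)=\inf_{\pi\in\Pi(\gamma_0,\gamma_1)}\int\|x_0-x_1\|^q+\|y_0-y_1\|^q\,d\pi(x_0,y_0,x_1,y_1)$. $\operatorname{diam}_{W_q}\Gamma(\rho,\mu)=\sup_{\gamma_0,\gamma_1\in\Gamma(\rho,\mu)}W_q(\gamma_0,\gamma_1)$. $\partial\phi$ is the convex subdifferential, $\partial\phi(\mathbb R^d)=\bigcup_x\partial\phi(x)$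 and $\operatorname{graph}(\partial\phi)=\{(x,y):y\in\partial\phi(x)\}$. *)

(* Defs.v *)
From HB Require Import structures.
From mathcomp Require Import all_boot all_order all_algebra.
From mathcomp Require Import all_classical all_reals all_analysis.

Set Implicit Arguments.
Unset Strict Implicit.
Unset Printing Implicit Defensive.

Import Order.TTheory GRing.Theory Num.Theory.
Import numFieldNormedType.Exports.

Local Open Scope classical_set_scope.
Local Open Scope ring_scope.

(** R^d with its Borel sigma-algebra.  Products [Rd R d * Rd R d] carry the
    product sigma-algebra, which is the Borel one since R^d is second
    countable. *)
Definition Rd (R : realType) (d : nat) :=
  g_sigma_algebraType (@open 'rV[R]_d).

Definition dotp (R : realType) (d : nat) (x y : 'rV[R]_d) : R :=
  \sum_(i < d) x 0 i * y 0 i.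

(** The norm [`|x|] which the library puts on ['rV[R]_d] is the sup norm, hence
    these separate definitions of the Euclidean norm and ball. *)
Definition enorm (R : realType) (d : nat) (x : 'rV[R]_d) : R :=
  Num.sqrt (dotp x x).

Definition eball (R : realType) (d : nat) (x : 'rV[R]_d) (eta : R) :
  set (Rd R d) := [set y : 'rV[R]_d | enorm (y - x) < eta].

Definition cube (R : realType) (d : nat) : set (Rd R d) :=
  [set x : 'rV[R]_d | forall i, -1 <= x 0 i <= 1].
Arguments cube R d : clear implicits.

(** [P(E)] for Borel [E] is the set of Borel probability measures on the ambient
    space that give mass one to [E]. *)
Definition probas_on (R : realType) (disp : measure_display)
    (T : measurableType disp) (E : set T) : set (probability T R) :=
  [set P | P E = 1%E].
Arguments probas_on R {disp T} E.

Definition ball_growth (R : realType) (d : nat) (M s : R)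
    (rho : probability (Rd R d) R) : Prop :=
  forall (x : 'rV[R]_d) (eta : R), 0 < eta ->
    (rho (eball x eta) <= (M * eta `^ s)%:E)%E.

(** [g = f_# rho] as Borel measures. *)
Definition is_pushforward (R : realType) (d1 d2 : measure_display)
    (T1 : measurableType d1) (T2 : measurableType d2) (f : T1 -> T2)
    (rho : probability T1 R) (g : probability T2 R) : Prop :=
  forall A : set T2, measurable A -> g A = pushforward rho f A.

Definition coupling (R : realType) (d1 d2 : measure_display)
    (T1 : measurableType d1) (T2 : measurableType d2)
    (rho : probability T1 R) (mu : probability T2 R) :
  set (probability (T1 * T2)%type R) :=
  [set g | is_pushforward fst g rho /\ is_pushforward snd g mu].

Definition quad_cost (R : realType) (d : nat)
    (g : probability (Rd R d * Rd R d)%type R) : \bar R :=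
  (\int[g]_z (enorm (z.1 - z.2 : 'rV[R]_d) ^+ 2)%:E)%E.

Definition optimal_plans (R : realType) (d : nat)
    (rho mu : probability (Rd R d) R) :
  set (probability (Rd R d * Rd R d)%type R) :=
  [set g | coupling rho mu g /\
    forall g', coupling rho mu g' -> (quad_cost g <= quad_cost g')%E].

(** Wasserstein distance on R^d, for [r] in [[1, +oo]]: ['N[g]_r] is the
    [L^r(g)] norm, the essential supremum when [r = +oo]. *)
Definition W (R : realType) (d : nat) (r : \bar R)
    (rho mu : probability (Rd R d) R) : \bar R :=
  ereal_inf [set ('N[g]_r[(fun z => (enorm (z.1 - z.2 : 'rV[R]_d))%:E)])%E
            | g in coupling rho mu].

(** The cost is the sum of the [q]-th powers of both displacements, hence the
    outer power [q^-1]. *)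
Definition Wplan (R : realType) (d : nat) (q : R)
    (g0 g1 : probability (Rd R d * Rd R d)%type R) : \bar R :=
  (ereal_inf
    [set \int[p]_z (enorm (z.1.1 - z.2.1 : 'rV[R]_d) `^ q
                    + enorm (z.1.2 - z.2.2 : 'rV[R]_d) `^ q)%:E
    | p in coupling g0 g1] `^ q^-1)%E.

Definition diam_Wplan (R : realType) (d : nat) (q : R)
    (G : set (probability (Rd R d * Rd R d)%type R)) : \bar R :=
  ereal_sup [set Wplan q g.1 g.2 | g in G `*` G].

Definition subdiff (R : realType) (d : nat) (phi : 'rV[R]_d -> R)
    (x : 'rV[R]_d) : set 'rV[R]_d :=
  [set y | forall z, phi x + dotp y (z - x) <= phi z].

Definition graph_subdiff (R : realType) (d : nat) (phi : 'rV[R]_d -> R) :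
  set ('rV[R]_d * 'rV[R]_d) := [set z | subdiff phi z.1 z.2].

(** A total function: entries whose partial derivative does not exist take an
    arbitrary default value.  A finite convex function is differentiable outside
    a set of Hausdorff dimension at most [d - 1], so that this convention is
    irrelevant up to null sets for the measures considered here. *)
Definition gradient (R : realType) (d : nat) (phi : 'rV[R]_d -> R)
    (x : 'rV[R]_d) : 'rV[R]_d :=
  \row_(i < d) 'D_(delta_mx 0 i) phi x.

Definition spt (R : realType) (d : nat)
    (g : probability (Rd R d * Rd R d)%type R) : set ('rV[R]_d * 'rV[R]_d) :=
  [set z | forall U : set ('rV[R]_d * 'rV[R]_d), open U -> U z -> (0 < g U)%E].

(** Only [q >= 1] and [r] in [[1, +oo]] are relevant, so
    that the last branch is the case [r = +oo]. *)
Definition nu (R : realType) (theta q : R) (r : \bar R) : R :=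
  match r with
  | EFin r0 => r0 * theta / (q * (r0 + theta))
  | _ => theta / q
  end.

Definition plans_estimate (R : realType) (d : nat) (q : R) (r : \bar R)
    (alpha : R) (X Y : set (Rd R d)) (rhobar : probability (Rd R d) R)
    (C : R) : Prop :=
  forall rho mu : probability (Rd R d) R,
    probas_on R X rho -> probas_on R Y mu ->
    (diam_Wplan q (optimal_plans rho mu) <= C%:E * W r rho rhobar `^ alpha)%E.

Definition maps_estimate (R : realType) (d : nat) (q : R) (r : \bar R)
    (alpha : R) (X Y : set (Rd R d)) (rhobar : probability (Rd R d) R)
    (C : R) : Prop :=
  forall (phi : 'rV[R]_d -> R)
         (g0 g1 : probability (Rd R d * Rd R d)%type R)
         (rho1 : probability (Rd R d) R),
    convex_function [set: 'rV[R]_d] phi ->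
    \bigcup_x subdiff phi x `<=` Y ->
    is_pushforward (fun x : Rd R d => (x, gradient phi x : Rd R d)) rhobar g0 ->
    probas_on R (X `*` Y) g1 ->
    is_pushforward fst g1 rho1 ->
    spt g1 `<=` graph_subdiff phi ->
    (Wplan q g0 g1 <= C%:E * W r rhobar rho1 `^ alpha)%E.

(* Main.v *)
Require Import Defs.
From HB Require Import structures.
From mathcomp Require Import all_boot all_order all_algebra.
From mathcomp Require Import all_classical all_reals all_analysis.
From mathcomp Require Import measurable_realfun.
From mathcomp Require Import ring lra.

Import Order.TTheory GRing.Theory Num.Theory.
Import numFieldNormedType.Exports.

Local Open Scope classical_set_scope.
Local Open Scope ring_scope.

Set Implicit Arguments.
Unset Strict Implicit.
Unset Printing Implicit Defensive.

(** All measures are laws of maps on one probability space, [R^d] with the uniform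
    law of the unit cube.  The map [X] has independent coordinates.  The first one
    is [u^(1/theta)], so that it is below [eps] with probability [eps^theta]; the
    second one is uniform on the union of [[-1,-1/2)] and [[1/2,1]], which leaves a
    gap between two halves; the others are uniform on [[0,1]].  The law [rhot] of
    [X] satisfies the growth condition coordinate by coordinate, because
    [x^theta - y^theta <= (x - y)^theta].

    Let [rho eps] be the law of the point obtained from [X] by projecting the slab
    [X_0 < eps] onto the hyperplane [x_0 = 0].  A mass at most [eps^theta] moves by
    at most [eps], whence the bound on [W_r] ([W_law_le], [W_collapse]).  Take
    targets in [{e0, -e0}].  A point with nonnegative first coordinate is at least
    as close to [e0] as to [-e0], with equality on the hyperplane.  So every plan
    costs at least the integral of [|x - e0|^2], and a plan that uses [-e0] from the
    hyperplane alone attains this bound ([optimal_plans_law],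
    [collapse_target_optimal]).  Two such plans send to [-e0] the two different
    halves [X_1 > 0] and [X_1 < 0] of the projected slab.  Transporting one plan onto
    the other moves a mass [eps^theta / 2] by a distance at least [1], either across
    the gap in [x_1] or between the two targets.  For this reason the distance of
    the plans is of order [eps^(theta/q)], and not merely [eps^theta]
    ([Wplan_law_ge], [Wplan_collapse_ge]).

    An estimate with exponent [alpha > nu] would bound [eps^(theta/q) / 8] by a
    constant times [eps^(beta * alpha)], where [beta = (r + theta) / r] (or [1]) and
    [beta * nu = theta / q]; this fails for small [eps] ([exponent_obstruction]).
    The first estimate is contradicted by the plans above.  For the second one,
    take [phi x = |x_0|]: its gradient is [e0] at every value of [X], its
    subdifferential contains both [e0] and [-e0] on the hyperplane, and the same
    transport argument separates the law of [(X, e0)] from one of the plans. *)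

(** * Borel measurability in Euclidean space *)

Section euclidean_borel.
Context {R : realType}.

Lemma dotp_ge0 d (x : 'rV[R]_d) : 0 <= dotp x x.
Proof. by apply: sumr_ge0 => i _; rewrite -expr2 sqr_ge0. Qed.

Lemma open_measurable_Rd d (U : set (Rd R d)) :
  @open 'rV[R]_d U -> measurable U.
Proof. exact: sub_sigma_algebra. Qed.

Lemma closed_measurable_Rd d (U : set (Rd R d)) :
  @closed 'rV[R]_d U -> measurable U.
Proof.
move=> cU; rewrite -(setCK U); apply: measurableC.
by apply: open_measurable_Rd; exact: closed_openC.
Qed.

Lemma measurable_coord d (i : 'I_d) :
  measurable_fun setT (fun x : Rd R d => (x : 'rV[R]_d) 0 i).
Proof.
apply: (measurability _ (RGenOInfty.measurableE R)) => _ [_ [x ->] <-].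
rewrite setTI; apply: open_measurable_Rd; apply: open_comp; last exact: rray_open.
by move=> y _; exact: coord_continuous.
Qed.

(** Second countability of [R^d], through boxes with rational centres: it reduces
    Borel measurability of maps into [R^d] to that of their coordinates. *)
Lemma open_rat_boxes d (U : set 'rV[R]_d) : open U ->
  let box (p : 'rV[rat]_d * nat) :=
    [set x : 'rV[R]_d | forall i, `|x 0 i - ratr (p.1 0 i)| < p.2.+1%:R^-1] in
  U = \bigcup_(p in [set p | box p `<=` U]) box p.
Proof.
move=> oU box; apply/seteqP; split=> [x Ux|x [p /= pU]]; last exact: pU.
have /nbhs_ballP[e /= e0 xeU] : nbhs x U by exact: open_nbhs_nbhs.
have [n n0] : exists n, n.+1%:R^-1 < e / 2.
  have [n _ /(_ n (leqnn n)) /=] :=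
    near_infty_natSinv_lt (PosNum (divr_gt0 e0 (@ltr0n R 2))).
  by exists n.
have /choice[q xq] : forall i, exists q : rat, `|x 0 i - ratr q| < n.+1%:R^-1.
  move=> i; have [q qx] : exists q : rat,
      ratr q \in `]x 0 i - n.+1%:R^-1, x 0 i + n.+1%:R^-1[.
    by apply: rat_in_itvoo; rewrite ltrD2l gtrN// invr_gt0.
  exists q; move: qx; rewrite in_itv/= ltr_norml => /andP[].
  by set r := _^-1 => ? ?; apply/andP; split; lra.
exists (\row_i q i, n) => /=; last by move=> i; rewrite mxE.
move=> y xy; apply: xeU; split => // i j; rewrite /ball/= ord1.
have := xy j; have := xq j; rewrite mxE !ltr_norml; move: n0; set r := _^-1.
by move=> ? /andP[? ?] /andP[? ?]; apply/andP; split; lra.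
Qed.

Lemma measurable_to_Rd d0 (T : measurableType d0) d (f : T -> Rd R d) :
  (forall i, measurable_fun setT (fun t => (f t : 'rV[R]_d) 0 i)) ->
  measurable_fun setT f.
Proof.
move=> mf.
apply: (@measurability _ _ T (Rd R d) setT f (@open 'rV[R]_d) erefl) => _ [U oU <-].
rewrite setTI (open_rat_boxes oU) preimage_bigcup bigcup_mkcond.
apply: countable_bigcupT_measurable; first exact: countableP.
move=> p; case: ifPn => // _.
rewrite (_ : _ @^-1` _ = \bigcap_(i in [set: 'I_d])
    ((fun t => (f t : 'rV[R]_d) 0 i) @^-1`
      [set x | `|x - ratr (p.1 0 i)| < p.2.+1%:R^-1])).
  apply: fin_bigcap_measurable => // i _.
  rewrite -[X in measurable X]setTI; apply: mf => //.
  rewrite (_ : [set _ | _] = ball (ratr (p.1 0 i) : R) p.2.+1%:R^-1).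
    exact: measurable_ball.
  by apply/seteqP; split => x /=; rewrite /ball/= distrC.
by apply/seteqP; split => [t /= ft i _|t /= ft i]; exact: ft.
Qed.

Lemma measurable_coord_comp d0 (T : measurableType d0) d (f : T -> Rd R d) i :
  measurable_fun setT f -> measurable_fun setT (fun t => (f t : 'rV[R]_d) 0 i).
Proof. by move=> mf; exact: (measurableT_comp (measurable_coord i) mf). Qed.

Lemma measurable_enorm_diff d0 (T : measurableType d0) d (f g : T -> Rd R d) :
  measurable_fun setT f -> measurable_fun setT g ->
  measurable_fun setT (fun t => enorm (f t - g t : 'rV[R]_d)).
Proof.
move=> mf mg; rewrite /enorm; under eq_fun do rewrite -powR12_sqrt ?dotp_ge0//.
apply: (measurableT_comp (measurable_powR _)); rewrite /dotp.
apply: measurable_sum => i; under eq_fun do rewrite !mxE.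
by apply: measurable_funM; apply: measurable_funB; exact: measurable_coord_comp.
Qed.

End euclidean_borel.

(** * Laws of maps and product measures *)

Section laws.
Context {R : realType}.

Lemma measurable_preimage {d1 d2} {T1 : measurableType d1}
    {T2 : measurableType d2} (f : T1 -> T2) (A : set T2) :
  measurable_fun setT f -> measurable A -> measurable (f @^-1` A).
Proof. by move=> mf mA; rewrite -[_ @^-1` _]setTI; apply: mf. Qed.

Lemma measurable_threshold {d1} {T1 : measurableType d1} (f : T1 -> R) (a : R) :
  measurable_fun setT f ->
  [/\ measurable [set x | f x < a], measurable [set x | f x <= a],
      measurable [set x | a < f x] & measurable [set x | a <= f x]].
Proof.
move=> mf; split.
- by apply: (measurable_preimage (A := [set t | t < a]) mf); rewrite -set_itvNyo.
- by apply: (measurable_preimage (A := [set t | t <= a]) mf); rewrite -set_itvNyc.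
- by apply: (measurable_preimage (A := [set t | a < t]) mf); rewrite -set_itvoy.
- by apply: (measurable_preimage (A := [set t | a <= t]) mf); rewrite -set_itvcy.
Qed.

(** The image measure, bundled as a probability: with all measures given as laws of
    maps on one space, a coupling is the law of a pair of maps. *)
Definition law {d1 d2} {T1 : measurableType d1} {T2 : measurableType d2}
    (P : probability T1 R) (f : T1 -> T2) (mf : measurable_fun setT f) :
  probability T2 R :=
  distribution P (HB.pack f (isMeasurableFun.Build _ _ _ _ f mf) : {mfun T1 >-> T2}).

Lemma lawE {d1 d2} {T1 : measurableType d1} {T2 : measurableType d2}
    (P : probability T1 R) (f : T1 -> T2) (mf : measurable_fun setT f) A :
  law P mf A = P (f @^-1` A).
Proof. by []. Qed.

Lemma integral_law {d1 d2} {T1 : measurableType d1} {T2 : measurableType d2}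
    (P : probability T1 R) (f : T1 -> T2) (mf : measurable_fun setT f)
    (h : T2 -> \bar R) : measurable_fun setT h -> (forall y, 0 <= h y)%E ->
  (\int[law P mf]_y h y = \int[P]_x h (f x))%E.
Proof. by move=> mh h0; rewrite ge0_integral_distribution. Qed.

(** The product of [n] copies of [m], carried by [R^n] with its Borel sets rather
    than by tuples; one coordinate is added at a time. *)
Lemma product_probability_Rd (m : probability (measurableTypeR R) R) n :
  exists P : probability (Rd R n) R, forall A : 'I_n -> set R,
    (forall i, measurable (A i)) ->
    (P [set x : 'rV[R]_n | forall i, A i (x 0%R i)] = \prod_(i < n) m (A i))%E.
Proof.
elim: n => [|n [P Pprod]].
  exists (@dirac _ (Rd R 0) (0%R : 'rV[R]_0) R) => A _.
  rewrite big_ord0 /= /dirac indicE mem_set//=.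
  by case.
pose cons (z : measurableTypeR R * Rd R n) : Rd R n.+1 :=
  \row_i if unlift ord0 i is Some j then (z.2 : 'rV[R]_n) 0 j else z.1.
have mcons : measurable_fun setT cons.
  apply: measurable_to_Rd => i; under eq_fun do rewrite mxE.
  case: unliftP => [j _|_]; last exact: measurable_fst.
  exact: measurable_coord_comp measurable_snd.
exists (law (m \x P)%E mcons) => A mA; rewrite lawE big_ord_recl.
rewrite -Pprod; last by move=> i; exact: mA.
rewrite -product_measure1E//; last first.
  rewrite (_ : [set _ | _] = \bigcap_(i in [set: 'I_n])
      ((fun x : Rd R n => (x : 'rV[R]_n) 0 i) @^-1` A (lift ord0 i))).
    apply: fin_bigcap_measurable => // i _.
    exact: (measurable_preimage (measurable_coord i) _).
  by apply/seteqP; split => [x /= Ax i _|x /= Ax i]; exact: Ax.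
  exact: mA.
rewrite /=; congr ((m \x P)%E _).
apply/seteqP; split=> [[t v] /= Az|[t v] /= [At Av] i].
  split; first by have := Az ord0; rewrite mxE unlift_none.
  by move=> i; have := Az (lift ord0 i); rewrite mxE liftK.
by rewrite mxE; case: unliftP => [j ->|->].
Qed.

End laws.

(** * Couplings of laws *)

Lemma W_ge0 (R : realType) d (r : \bar R) (rho mu : probability (Rd R d) R) :
  (0 <= W r rho mu)%E.
Proof. by apply: le_ereal_inf_tmp => _ [g _ <-]; exact: Lnorm_ge0. Qed.

Section couplings.
Context {R : realType} {d0 : measure_display} {Om : measurableType d0}.
Variable P : probability Om R.

Lemma coupling_law {d1 d2} {T1 : measurableType d1} {T2 : measurableType d2}
    (X : Om -> T1) (Y : Om -> T2) (mX : measurable_fun setT X)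
    (mY : measurable_fun setT Y) :
  coupling (law P mX) (law P mY) (law P (measurable_fun_pair mX mY)).
Proof. by split=> A mA. Qed.

(** Two maps on the same space give a coupling of their laws, whose cost is
    supported on the set [N] where the maps differ. *)
Lemma W_law_le d (X Y : Om -> Rd R d) (mX : measurable_fun setT X)
    (mY : measurable_fun setT Y) (N : set Om) (eps delta : R) (r : \bar R) :
  measurable N -> 0 <= eps -> (P N <= delta%:E)%E -> (1 <= r)%E ->
  (forall w, enorm (X w - Y w : 'rV[R]_d) <= eps) ->
  (forall w, ~ N w -> X w = Y w) ->
  (W r (law P mX) (law P mY) <= (match r with
     | EFin r0 => (eps `^ r0 * delta) `^ r0^-1
     | _ => eps end)%:E)%E.
Proof.
move=> mN eps0 PN r1 XYeps XYN.
have menorm : measurable_fun setT (fun z : Rd R d * Rd R d =>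
    (enorm (z.1 - z.2 : 'rV[R]_d))%:E).
  by apply/measurable_EFinP; apply: measurable_enorm_diff.
apply: ge_ereal_inf; eexists.
  by exists (law P (measurable_fun_pair mX mY)); first exact: coupling_law.
rewrite unlock; case: r r1 => [r0| |//] r1.
  have r0_gt0 : 0 < r0 by rewrite (lt_le_trans ltr01)// -lee_fin.
  rewrite integral_law; last 2 first.
  - by apply: (measurableT_comp (measurable_poweR _)); apply: measurableT_comp.
  - by move=> y; exact: poweR_ge0.
  have delta0 : 0 <= delta by rewrite -lee_fin (le_trans _ PN).
  rewrite -poweR_EFin; apply: gt0_ler_poweR.
  - by rewrite invr_ge0 ltW.
  - by rewrite in_itv/= leey andbT; exact: integral_ge0.
  - by rewrite in_itv/= leey andbT lee_fin mulr_ge0// powR_ge0.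
  apply: (@le_trans _ _ (\int[P]_w ((eps `^ r0)%:E * (\1_N w)%:E))%E).
    apply: ge0_le_integral => //.
    - by move=> w _; exact: poweR_ge0.
    - apply: (measurableT_comp (measurable_poweR _)).
      apply: measurableT_comp => //.
      by apply/measurable_EFinP; exact: measurable_enorm_diff.
    - by apply: emeasurable_funM => //; apply/measurable_EFinP.
    move=> w _ /=; rewrite ger0_norm ?sqrtr_ge0// lee_fin indicE.
    case: (pselect (N w)) => Nw.
      rewrite mem_set// mulr1; apply: ge0_ler_powR => //.
      - exact: ltW.
      - by rewrite nnegrE sqrtr_ge0.
    rewrite memNset// mulr0 XYN// subrr /enorm /dotp.
    rewrite big1 => [|i _]; last by rewrite mxE mul0r.
    by rewrite sqrtr0 powR0// gt_eqF.
  rewrite ge0_integralZl//; last 2 first.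
  - by apply/measurable_EFinP.
  - by rewrite lee_fin powR_ge0.
  rewrite integral_indic// setIT EFinM; apply: lee_pmul => //.
  by rewrite lee_fin powR_ge0.
case: ifP => [_|_]; last by rewrite lee_fin.
set f := abse \o _.
have mf : measurable_fun setT f by apply: measurableT_comp.
apply/ess_sup_inf.ess_supP; apply/ess_sup_inf.ae_le_measureP => //.
rewrite -[LHS]/(P (_ @^-1` (f @^-1` `]eps%:E, +oo[))).
rewrite [X in P X](_ : _ = set0) ?measure0//.
apply/seteqP; split => w //=; rewrite in_itv/= andbT lte_fin.
by rewrite ger0_norm ?sqrtr_ge0// ltNge XYeps.
Qed.

(** The first marginal gives [A] the mass that the second one gives to the
    complement of [B], plus at least the mass of [E]; a coupling cannot store this
    excess over the complement of [B], so it lies in [A `*` B]. *)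
Lemma coupling_mass_ge {d1 d2} {T1 : measurableType d1} {T2 : measurableType d2}
    (X : Om -> T1) (Y : Om -> T2) (mX : measurable_fun setT X)
    (mY : measurable_fun setT Y) (A : set T1) (B : set T2) (E : set Om) p :
  measurable A -> measurable B -> measurable E ->
  (forall w, ~ B (Y w) -> A (X w)) -> (forall w, E w -> A (X w) /\ B (Y w)) ->
  coupling (law P mX) (law P mY) p -> (P E <= p (A `*` B))%E.
Proof.
move=> mA mB mE YX EXY [pX pY].
have mXA : measurable (X @^-1` A) by exact: (measurable_preimage mX mA).
have mYB : measurable (Y @^-1` ~` B).
  exact: (measurable_preimage mY (measurableC mB)).
have mAT : measurable (A `*` [set: T2]) by exact: measurableX.
have mAB : measurable (A `*` B) by exact: measurableX.
have mTB : measurable ([set: T1] `*` ~` B).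
  by apply: measurableX => //; exact: measurableC.
have pA : p (A `*` setT) = P (X @^-1` A).
  rewrite -[RHS]/(law P mX A) pX//; congr (p _).
  by apply/seteqP; split => z //= [].
have pB : p (setT `*` ~` B) = P (Y @^-1` ~` B).
  rewrite -[RHS]/(law P mY (~` B)) pY; last exact: measurableC.
  congr (p _).
  by apply/seteqP; split => z //= [].
rewrite -(@leeD2rE _ (P (Y @^-1` ~` B))) ?fin_num_measure//.
rewrite -measureU//; last first.
  by apply/seteqP; split => // w [/EXY[_ ?]].
apply: (@le_trans _ _ (P (X @^-1` A))).
  apply: le_measure; rewrite ?inE//; first exact: measurableU.
  by move=> w [/EXY[]//|/YX].
rewrite -pA -pB; apply: le_trans (measureU2 _ _ _) => //.
apply: le_measure; rewrite ?inE//; first exact: measurableU.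
move=> [x y] [/= Ax _]; have [By|nBy] := pselect (B y); first by left.
by right.
Qed.

(** A mass that has to travel a distance at least [1] contributes itself, and not
    its [q]-th power, to the [q]-cost. *)
Lemma Wplan_law_ge d (X Y : Om -> Rd R d * Rd R d)
    (mX : measurable_fun setT X) (mY : measurable_fun setT Y)
    (A B : set (Rd R d * Rd R d)) (E : set Om) (q : R) :
  measurable A -> measurable B -> measurable E -> 0 < q ->
  (forall w, ~ B (Y w) -> A (X w)) -> (forall w, E w -> A (X w) /\ B (Y w)) ->
  (forall x y, A x -> B y ->
    1 <= enorm (x.1 - y.1 : 'rV[R]_d) \/ 1 <= enorm (x.2 - y.2 : 'rV[R]_d)) ->
  (P E `^ q^-1 <= Wplan q (law P mX) (law P mY))%E.
Proof.
move=> mA mB mE q0 YX EXY AB1.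
have cost_ge0 (z : (Rd R d * Rd R d) * (Rd R d * Rd R d)) :
    (0 <= (enorm (z.1.1 - z.2.1 : 'rV[R]_d) `^ q
      + enorm (z.1.2 - z.2.2 : 'rV[R]_d) `^ q)%:E)%E.
  by rewrite lee_fin addr_ge0// powR_ge0.
apply: gt0_ler_poweR.
- by rewrite invr_ge0 ltW.
- by rewrite in_itv/= leey andbT.
- rewrite in_itv/= leey andbT; apply: le_ereal_inf_tmp => _ [p _ <-].
  by apply: integral_ge0 => z _.
apply: le_ereal_inf_tmp => _ [p pXY <-].
have mAB : measurable (A `*` B) by exact: measurableX.
apply: le_trans (coupling_mass_ge mA mB mE YX EXY pXY) _.
rewrite -[A `*` B]setIT -(integral_indic p measurableT mAB).
apply: ge0_le_integral => //.
- by apply/measurable_EFinP.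
- apply/measurable_EFinP; apply: measurable_funD;
    apply: (measurableT_comp (measurable_powR _)); apply: measurable_enorm_diff;
    by apply: measurableT_comp.
move=> [x y] _; rewrite lee_fin indicE.
have [/set_mem[/= Ax By]|_] := boolP (_ \in _); last by rewrite addr_ge0// powR_ge0.
have ge1 t : 1 <= t -> 1 <= t `^ q.
  move=> t1; have <- : 1 `^ q = 1 :> R by rewrite powR1.
  apply: ge0_ler_powR => //; [exact: ltW|by rewrite nnegrE|].
  by rewrite nnegrE (le_trans ler01).
have [/ge1 le1|/ge1 le1] := AB1 _ _ Ax By.
  by rewrite (le_trans le1)// lerDl powR_ge0.
by rewrite (le_trans le1)// lerDr powR_ge0.
Qed.

(** The cost of every coupling is bounded below by the integral of
    [|x - e|^2], which depends on the first marginal alone; a plan with this cost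
    is therefore optimal. *)
Lemma optimal_plans_law d (X Y : Om -> Rd R d) (mX : measurable_fun setT X)
    (mY : measurable_fun setT Y) (mu : probability (Rd R d) R)
    (S T : set (Rd R d)) (e : 'rV[R]_d) :
  is_pushforward Y P mu -> measurable S -> measurable T ->
  (forall w, S (X w)) -> (forall w, T (Y w)) ->
  (forall x y : 'rV[R]_d, S x -> T y -> enorm (x - e) <= enorm (x - y)) ->
  (forall w, enorm (X w - Y w : 'rV[R]_d) = enorm (X w - e : 'rV[R]_d)) ->
  optimal_plans (law P mX) mu (law P (measurable_fun_pair mX mY)).
Proof.
move=> Ymu mS mT XS YT eST XYe.
split; first by split => A mA; [|rewrite Ymu].
have msq d' (T' : measurableType d') (f g : T' -> Rd R d) : measurable_fun setT f ->
    measurable_fun setT g ->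
    measurable_fun setT (fun z => (enorm (f z - g z : 'rV[R]_d) ^+ 2)%:E).
  move=> mf mg; apply/measurable_EFinP; apply: measurable_funX.
  exact: measurable_enorm_diff.
have sq_ge0 (x : 'rV[R]_d) : (0 <= (enorm x ^+ 2)%:E)%E by rewrite lee_fin sqr_ge0.
move=> g [gX gY]; rewrite /quad_cost integral_law//; last exact: msq.
have -> : (\int[P]_w (enorm (X w - Y w : 'rV[R]_d) ^+ 2)%:E
    = \int[g]_z (enorm (z.1 - e : 'rV[R]_d) ^+ 2)%:E)%E.
  transitivity (\int[law P mX]_x (enorm (x - e : 'rV[R]_d) ^+ 2)%:E)%E.
    rewrite integral_law//; last exact: (msq _ _ id (cst e)).
    by apply: eq_integral => w _; rewrite XYe.
  transitivity (\int[pushforward g fst]_x (enorm (x - e : 'rV[R]_d) ^+ 2)%:E)%E.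
    by apply: eq_measure_integral => A mA _; exact: (gX A mA).
  rewrite ge0_integral_pushforward//; last exact: (msq _ _ id (cst e)).
apply: ae_ge0_le_integral => //; [exact: msq|exact: msq|].
have aeS : {ae g, forall z, S z.1}.
  exists (fst @^-1` ~` S); split=> //.
  - exact: (measurable_preimage measurable_fst (measurableC mS)).
  - rewrite -[LHS](gX (~` S) (measurableC mS)) -[LHS]/(P (X @^-1` ~` S)).
    rewrite (_ : _ @^-1` _ = set0) ?measure0//.
    by apply/seteqP; split => w //=; apply; exact: XS.
have aeT : {ae g, forall z, T z.2}.
  exists (snd @^-1` ~` T); split=> //.
  - exact: (measurable_preimage measurable_snd (measurableC mT)).
  - rewrite -[LHS](gY (~` T) (measurableC mT)) Ymu; last exact: measurableC.
    rewrite /pushforward (_ : _ @^-1` _ = set0) ?measure0//.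
    by apply/seteqP; split => w //=; apply; exact: YT.
apply: filterS2 aeS aeT => z Sz Tz _.
by rewrite lee_fin lerXn2r ?nnegrE ?sqrtr_ge0//; exact: eST.
Qed.
End couplings.

(** * One-dimensional profiles *)

Section one_dimensional_profiles.
Context {R : realType}.

Let U : probability (measurableTypeR R) R := uniform_prob (@ltr01 R).
Local Notation lambda := (@lebesgue_measure R).

(** Subadditivity of [t^theta]: for [0 <= z <= x], [z / x <= (z / x)^theta]; add
    this for [z = y] and [z = x - y]. *)
Lemma powRB_le (theta x y : R) : 0 < theta <= 1 -> 0 <= y <= x ->
  x `^ theta - y `^ theta <= (x - y) `^ theta.
Proof.
move=> /andP[t0 t1] /andP[y0 yx].
have [x0|x0] := leP x 0.
  have y_0 : y = 0 by apply/le_anti; rewrite y0 (le_trans yx).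
  by rewrite y_0 powR0 ?gt_eqF// !subr0.
have part (z : R) : 0 <= z <= x -> z / x * x `^ theta <= z `^ theta.
  move=> /andP[z0 zx].
  have -> : z `^ theta = (z / x) `^ theta * x `^ theta.
    by rewrite -powRM ?divr_ge0 ?(ltW x0)// divfK ?gt_eqF.
  apply: ler_wpM2r; first exact: powR_ge0.
  have [->|zn0] := eqVneq z 0; first by rewrite mul0r powR_ge0.
  apply: ger1_powR => //.
  by rewrite divr_gt0 ?ler_pdivrMr ?mul1r// lt_neqAle eq_sym zn0.
have xy : 0 <= x - y <= x by rewrite subr_ge0 yx gerBl.
have yx' : 0 <= y <= x by rewrite y0.
have := lerD (part _ xy) (part _ yx').
by rewrite -mulrDl -mulrDl subrK divff ?gt_eqF// mul1r lerBlDr.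
Qed.

(** The half-open interval lets the profiles below be analysed at positive
    arguments only. *)
Lemma uniform01E (A : set R) : measurable A -> U A = lambda (A `&` `]0, 1]).
Proof.
move=> mA; transitivity (lambda (A `&` `[0, 1])).
  rewrite /U /= /uniform_prob integral_uniform_pdf.
  rewrite (eq_integral (fun=> 1%E)); last first.
    move=> x; rewrite inE/= in_itv/= => -[_ x01].
    by rewrite /uniform_pdf x01 subr0 invr1.
  by rewrite integral_cst ?mul1e//; exact: measurableI.
apply/le_anti/andP; split; last first.
  apply: le_measure; rewrite ?inE//; [exact: measurableI|exact: measurableI|].
  by apply: setIS; exact: subset_itv_oc_cc.
apply: (@le_trans _ _ (lambda ((A `&` `]0, 1]) `|` [set 0]))).
  apply: le_measure; rewrite ?inE//; first exact: measurableI.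
    by apply: measurableU => //; exact: measurableI.
  move=> x [Ax]; rewrite /= !in_itv/= le_eqVlt => /andP[/orP[/eqP<-|x0] x1].
    by right.
  by left; rewrite x0.
apply: le_trans (measureU2 _ _ _) _ => //; first exact: measurableI.
by rewrite [X in (_ + X)%E]lebesgue_measure_set1 adde0.
Qed.

Lemma uniform01_itv_le (A : set R) (a b : R) : measurable A -> a <= b ->
  A `&` `]0, 1] `<=` `[a, b] -> (U A <= (b - a)%:E)%E.
Proof.
move=> mA ab Aab; rewrite uniform01E//.
apply: (@le_trans _ _ (lambda `[a, b])).
  by apply: le_measure; rewrite ?inE//; apply: measurableI.
rewrite lebesgue_measure_itv/= lte_fin; case: ifP => // _.
by rewrite lee_fin subr_ge0.
Qed.

(** The coordinates of the model as functions of a uniform variable.  The default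
    value [1] outside the unit interval makes the bounds below hold everywhere and
    not just almost everywhere. *)
Definition profile (theta : R) (i : nat) (u : R) : R :=
  match i with
  | 0 => if 0 < u <= 1 then u `^ theta^-1 else 1
  | 1 => if 0 <= u < 2^-1 then u - 1 else if 2^-1 <= u <= 1 then u else 1
  | _ => if 0 <= u <= 1 then u else 1
  end.

Lemma measurable_profile theta i :
  measurable_fun setT (profile theta i).
Proof.
have mge (a : R) : measurable_fun setT (fun u : R => a <= u).
  exact: measurable_fun_ler.
have mle (a : R) : measurable_fun setT (fun u : R => u <= a).
  exact: measurable_fun_ler.
have mgt (a : R) : measurable_fun setT (fun u : R => a < u).
  exact: measurable_fun_ltr.
have mlt (a : R) : measurable_fun setT (fun u : R => u < a).
  exact: measurable_fun_ltr.
case: i => [|[|i]]; rewrite /profile.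
- by apply: measurable_fun_ifT => //; exact: measurable_and.
- apply: measurable_fun_ifT => //; first exact: measurable_and.
    exact: measurable_funB.
  by apply: measurable_fun_ifT => //; exact: measurable_and.
- by apply: measurable_fun_ifT => //; exact: measurable_and.
Qed.

Lemma profile_bound theta i u : 0 < theta -> `|profile theta i u| <= 1.
Proof.
move=> t0; case: i => [|[|i]] /=.
- case: ifPn => [/andP[u0 u1]|_]; last by rewrite normr1.
  rewrite ger0_norm ?powR_ge0//.
  have <- : 1 `^ theta^-1 = 1 :> R by rewrite powR1.
  by apply: ge0_ler_powR; rewrite ?nnegrE ?invr_ge0// ltW.
- case: ifPn => [/andP[u0 u1]|_]; first by rewrite ler_norml; apply/andP; split; lra.
  case: ifPn => [/andP[u0 u1]|_]; last by rewrite normr1.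
  by rewrite ler_norml; apply/andP; split; lra.
- case: ifPn => [/andP[u0 u1]|_]; last by rewrite normr1.
  by rewrite ger0_norm.
Qed.

Lemma profile0_gt0 theta u : 0 < profile theta 0 u.
Proof. by rewrite /=; case: ifPn => [/andP[u0 _]|//]; exact: powR_gt0. Qed.

Lemma profile1_ge theta u : 2^-1 <= `|profile theta 1 u|.
Proof.
rewrite /=; case: ifPn => [/andP[u0 u1]|_]; first by rewrite ler0_norm; lra.
case: ifPn => [/andP[u0 u1]|_]; last by rewrite normr1; lra.
by rewrite ger0_norm; lra.
Qed.

Lemma measurable_profile_ball theta i (a eta : R) :
  measurable (profile theta i @^-1` [set t | `|t - a| < eta] : set R).
Proof.
apply: (measurable_preimage (measurable_profile theta i)).
rewrite (_ : [set _ | _] = ball a eta); first exact: measurable_ball.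
by apply/seteqP; split => x /=; rewrite /ball/= distrC.
Qed.

(** The preimage of an interval of length [2 * eta] is contained in an interval of
    length at most [(2 * eta)^theta] (index [0]), in two intervals of length
    [2 * eta] (index [1]), or in one such interval. *)
Lemma uniform01_profile_ball theta i (a eta : R) : 0 < theta <= 1 -> 0 < eta ->
  (U (profile theta i @^-1` [set t | (`|t - a| < eta)%R]) <=
   (4 * eta `^ (if i == 0 then theta else 1))%:E)%E.
Proof.
move=> /[dup] ht /andP[t0 t1] eta0.
have mB := measurable_profile_ball theta i a eta.
case: i mB => [|[|i]]; rewrite /profile => mB /=.
- have [ae|ae] := leP (a + eta) 0.
    rewrite uniform01E// (_ : _ `&` _ = set0) ?measure0.
      by rewrite lee_fin mulr_ge0// powR_ge0.
    apply/seteqP; split => u //= [].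
    have := profile0_gt0 theta u; rewrite /= ltr_norml.
    by set v := (if _ then _ else _) => ? /andP[? ?]; lra.
  (* [b] is the left end of the part of the ball met by positive values. *)
  pose b := Num.max (a - eta) 0.
  have b0 : 0 <= b by rewrite le_max lexx orbT.
  have bae : b <= a + eta by rewrite ge_max; apply/andP; split; lra.
  apply: (@le_trans _ _ ((a + eta) `^ theta - b `^ theta)%:E).
    apply: uniform01_itv_le => //.
      by apply: ge0_ler_powR; rewrite ?nnegrE// ltW.
    move=> u /= []; rewrite !in_itv/=; case: ifPn => [/andP[u0 u1]|].
      move=> uae _.
      have -> : u = (u `^ theta^-1) `^ theta.
        by rewrite -powRrM mulVf ?gt_eqF// powRr1// ltW.
      move: uae; rewrite ltr_norml => /andP[ua1 ua2].
      apply/andP; split; (apply: ge0_ler_powR; first exact: ltW);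
        rewrite ?nnegrE ?powR_ge0 ?(ltW ae)//.
        by rewrite ge_max powR_ge0 andbT; lra.
      by lra.
    by [].
  rewrite lee_fin (le_trans (powRB_le ht _))//; first by rewrite b0.
  have le2 : a + eta - b <= 2 * eta.
    have : a - eta <= b by rewrite le_max lexx.
    lra.
  apply: (@le_trans _ _ ((2 * eta) `^ theta)).
    apply: ge0_ler_powR => //; first exact: ltW.
    - by rewrite nnegrE subr_ge0.
    - by rewrite nnegrE; lra.
  rewrite powRM//; last exact: ltW.
  rewrite ler_wpM2r ?powR_ge0//.
  apply: (@le_trans _ _ 2); last lra.
  by apply: ler1_powR => //; lra.
- rewrite powRr1; last exact: ltW.
  rewrite uniform01E//.
  (* The negative branch [u - 1] puts [u] in the translated interval. *)
  apply: (@le_trans _ _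
    (lambda (`[a - eta, a + eta] `|` `[a + 1 - eta, a + 1 + eta]))).
    apply: le_measure; rewrite ?inE//.
    - exact: measurableI.
    - exact: measurableU.
    move=> u /= []; rewrite !in_itv/= => h /andP[/ltW u0 u1]; move: h.
    rewrite u0 u1 andbT /=; case: (ltP u 2^-1) => u2; rewrite ltr_norml => /andP[? ?].
      by right; apply/andP; split; lra.
    by left; apply/andP; split; lra.
  apply: (@le_trans _ _ (lambda `[(a - eta)%R, (a + eta)%R] +
                         lambda `[(a + 1 - eta)%R, (a + 1 + eta)%R])%E).
    exact: measureU2.
  rewrite !lebesgue_measure_itv/= !lte_fin.
  by rewrite !ifT; [rewrite -EFinB -EFinB -EFinD lee_fin; lra|lra|lra].
- rewrite powRr1; last exact: ltW.
  apply: (@le_trans _ _ ((a + eta) - (a - eta))%:E); last by rewrite lee_fin; lra.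
  apply: uniform01_itv_le => //; first lra.
  move=> u /= []; rewrite !in_itv/= => h /andP[/ltW u0 u1]; move: h; rewrite u0 u1 /=.
  by rewrite ltr_norml => /andP[? ?]; apply/andP; split; lra.
Qed.

Lemma uniform01_profile0_lt theta (eps : R) : 0 < theta -> 0 <= eps <= 1 ->
  U (profile theta 0 @^-1` [set t | t < eps]) = (eps `^ theta)%:E.
Proof.
move=> t0 /andP[eps0 eps1].
have mA : measurable (profile theta 0 @^-1` [set t | t < eps] : set R).
  apply: (measurable_preimage (measurable_profile theta 0)).
  by rewrite -set_itvNyo.
rewrite uniform01E// (_ : _ `&` _ = `]0, eps `^ theta[%classic).
  rewrite lebesgue_measure_itv/= lte_fin; case: ltP => [_|e0].
    by rewrite -EFinB subr0.
  by congr (_%:E); apply/le_anti; rewrite e0 powR_ge0.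
have powK (x : R) : 0 <= x -> x = (x `^ theta) `^ theta^-1.
  by move=> x0; rewrite -powRrM mulfV ?gt_eqF// powRr1.
have it0 : 0 < theta^-1 by rewrite invr_gt0.
apply/seteqP; split => u /=; rewrite /= !in_itv/=.
  move=> [+ /[dup] u01 /andP[u0 u1]]; rewrite u01 => ue.
  rewrite u0/= ltNge; apply/negP => eu.
  have := ge0_ler_powR (ltW it0) _ _ eu.
  rewrite -powK// !nnegrE powR_ge0 (ltW u0) leNgt ue => /(_ isT isT).
  by [].
move=> /andP[u0 ue].
have u1 : u <= 1.
  apply: (le_trans (ltW ue)); have <- : 1 `^ theta = 1 :> R by rewrite powR1.
  by apply: ge0_ler_powR; rewrite ?nnegrE// ltW.
rewrite u0 u1/=; split=> //; rewrite [ltRHS]powK//.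
by apply: gt0_ltr_powR; rewrite ?nnegrE ?powR_ge0 ?(ltW u0).
Qed.

Lemma uniform01_profile1_sign theta (s : bool) :
  U (profile theta 1 @^-1` [set t | if s then 0 < t else t < 0]) = (2^-1)%:E.
Proof.
have mA : measurable
    (profile theta 1 @^-1` [set t | if s then 0 < t else t < 0] : set R).
  apply: (measurable_preimage (measurable_profile theta 1)).
  by case: s; rewrite -?set_itvNyo -?set_itvoy.
rewrite uniform01E// (_ : _ `&` _ =
    if s then `[2^-1, 1]%classic else `]0, 2^-1[%classic).
  case: s {mA}; rewrite lebesgue_measure_itv/= lte_fin.
    rewrite ifT; last lra.
    by rewrite -EFinB; congr (_%:E); lra.
  rewrite ifT; last lra.
  by rewrite -EFinB subr0.
apply/seteqP; split => u /=; rewrite in_itv/=.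
  move=> [h /andP[u0 u1]]; move: h; rewrite u1 (ltW u0)/= andbT.
  case: (ltP u 2^-1) => u2; case: s {mA}; rewrite /= in_itv/=.
  - lra.
  - by rewrite u0.
  - by rewrite u2.
  - lra.
case: s {mA}; rewrite /= in_itv/= => /andP[u0 u1].
  rewrite u0 u1 (ltNge u) u0 andbF/=; split; lra.
by rewrite (ltW u0) u1/= u0/=; split; lra.
Qed.

End one_dimensional_profiles.

(** * The model measure *)

Section model.
Context {R : realType}.

Lemma coord_le_enorm d (x : 'rV[R]_d) i : `|x 0 i| <= enorm x.
Proof.
rewrite -sqrtr_sqr; apply: ler_wsqrtr; rewrite /dotp (bigD1 i)//= -expr2 lerDl.
by apply: sumr_ge0 => j _; rewrite -expr2 sqr_ge0.
Qed.

Lemma enorm_distC d (x y : 'rV[R]_d) : enorm (x - y) = enorm (y - x).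
Proof.
by rewrite /enorm /dotp; congr Num.sqrt; apply: eq_bigr => i _; rewrite !mxE; ring.
Qed.

Lemma measurable_eball d (x : 'rV[R]_d) eta : measurable (eball x eta).
Proof.
have m := @measurable_enorm_diff R _ (Rd R d) d id (cst x)
  (@measurable_id _ _ _) (measurable_cst _).
by have [] := measurable_threshold eta m.
Qed.

Lemma lee_prod_ord n (f g : 'I_n -> \bar R) : (forall i, 0 <= f i <= g i)%E ->
  (\prod_(i < n) f i <= \prod_(i < n) g i)%E.
Proof.
move=> fg; suff /andP[] : (0 <= \prod_(i < n) f i <= \prod_(i < n) g i)%E by [].
elim/big_ind2 : _ => [|a b x y /andP[b0 ba] /andP[y0 yx]|i _] //.
  by rewrite lexx lee01.
by apply/andP; split; [exact: mule_ge0|exact: lee_pmul].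
Qed.

(** The only properties of the model used below: bounds that hold everywhere, the
    growth of the law, and the mass of the two halves of the slab [x0 < eps]. *)
Lemma model_exists (theta : R) n : 0 < theta <= 1 ->
  exists (P : probability (Rd R n.+2) R) (X : Rd R n.+2 -> Rd R n.+2)
    (mX : measurable_fun setT X),
  let x0 w := (X w : 'rV[R]_n.+2) 0 ord0 in
  let x1 w := (X w : 'rV[R]_n.+2) 0 (lift ord0 ord0) in
  [/\ forall w i, `|(X w : 'rV[R]_n.+2) 0 i| <= 1,
      forall w, 0 < x0 w,
      forall w, 2^-1 <= `|x1 w|,
      exists M : R, 0 < M /\ ball_growth M (n.+2%:R - 1 + theta) (law P mX)
    & forall (eps : R) (s : bool), 0 <= eps <= 1 ->
      P [set w | x0 w < eps /\ (if s then 0 < x1 w else x1 w < 0)]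
      = (eps `^ theta / 2)%:E].
Proof.
move=> /[dup] ht /andP[t0 t1].
have [P Pprod] := product_probability_Rd (uniform_prob (@ltr01 R)) n.+2.
pose X (w : Rd R n.+2) : Rd R n.+2 := \row_i profile theta i ((w : 'rV[R]_n.+2) 0 i).
have mX : measurable_fun setT X.
  apply: measurable_to_Rd => i; under eq_fun do rewrite mxE.
  exact: (measurableT_comp (measurable_profile theta i) (measurable_coord i)).
have PX (B : 'I_n.+2 -> set R) : (forall i, measurable (B i)) ->
    (P [set w | forall i, B i ((X w : 'rV[R]_n.+2) 0%R i)] =
     \prod_(i < n.+2) uniform_prob (@ltr01 R) (profile theta i @^-1` B i))%E.
  move=> mB; rewrite -Pprod; last first.
    by move=> i; exact: (measurable_preimage (measurable_profile theta i) (mB i)).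
  by congr (P _); apply/seteqP; split => w /= h i; have := h i; rewrite mxE.
exists P, X, mX; split => /=.
- by move=> w i; rewrite mxE; exact: profile_bound.
- by move=> w; rewrite mxE; exact: profile0_gt0.
- by move=> w; rewrite mxE; exact: profile1_ge.
- exists (4 ^+ n.+2); split; first by rewrite exprn_gt0.
  move=> x eta eta0.
  pose B (i : 'I_n.+2) := [set t : R | `|t - x 0 i| < eta].
  have mB i : measurable (B i).
    rewrite (_ : B i = ball (x 0 i) eta); first exact: measurable_ball.
    by apply/seteqP; split => t /=; rewrite /B /ball/= distrC.
  have mXB : measurable [set w | forall i, B i ((X w : 'rV[R]_n.+2) 0 i)].
    rewrite (_ : [set _ | _] = \bigcap_(i in [set: 'I_n.+2])
        ((fun w => (X w : 'rV[R]_n.+2) 0 i) @^-1` B i)).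
      apply: fin_bigcap_measurable => // i _.
      by apply: (measurable_preimage (measurable_coord_comp i mX)).
    by apply/seteqP; split => [w /= h i _|w /= h i]; exact: h.
  apply: (@le_trans _ _ (P [set w | forall i, B i ((X w : 'rV[R]_n.+2) 0 i)])).
    apply: (@le_measure _ _ _ P (X @^-1` eball x eta)); rewrite ?inE//.
      exact: (measurable_preimage mX (measurable_eball x eta)).
    move=> w /= Xwx i; rewrite /B/=; apply: le_lt_trans Xwx.
    by have := coord_le_enorm (X w - x : 'rV[R]_n.+2) i; rewrite !mxE.
  rewrite PX//.
  apply: (@le_trans _ _ (\prod_(i < n.+2)
      (4 * eta `^ (if i == 0 :> nat then theta else 1))%:E)%E).
    by apply: lee_prod_ord => i; rewrite measure_ge0 uniform01_profile_ball.
  rewrite prodEFin lee_fin big_split/= prodr_const card_ord.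
  rewrite ler_wpM2l ?exprn_ge0// big_ord_recl/= prodr_const card_ord.
  rewrite powRr1; last exact: ltW.
  rewrite -powR_mulrn; last exact: ltW.
  rewrite -powRD; last by rewrite (gt_eqF eta0) implybT.
  by rewrite -[n.+2]addn1 natrD addrK addrC.
- move=> eps s /[dup] he /andP[eps0 eps1].
  pose B (i : 'I_n.+2) := match i : nat with
    | 0 => [set t : R | t < eps]
    | 1 => [set t : R | if s then 0 < t else t < 0]
    | _ => setT end.
  rewrite (_ : [set _ | _] = [set w | forall i, B i ((X w : 'rV[R]_n.+2) 0 i)]).
    rewrite PX; last first.
      rewrite /B; case=> -[|[|i]] /= _ //; first by rewrite -set_itvNyo.
      by case: (s); rewrite -?set_itvNyo -?set_itvoy.
    rewrite !big_ord_recl uniform01_profile0_lt// uniform01_profile1_sign.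
    by rewrite big1 ?mule1// => i _; exact: probability_setT.
  apply/seteqP; split => [w [? ?] i|w /= h].
    have [->//|->//|[k ->]//] : [\/ i = ord0, i = lift ord0 ord0
        | exists k, i = lift ord0 (lift ord0 k)].
      case: (unliftP ord0 i) => [j ->|->]; last by constructor 1.
      case: (unliftP ord0 j) => [k ->|->]; last by constructor 2.
      by constructor 3; exists k.
  by split; [exact: (h ord0)|exact: (h (lift ord0 ord0))].
Qed.

End model.

(** * Comparison of exponents *)

Section exponent_obstruction.
Context {R : realType}.

(** With [beta] the exponent of [eps] in the bound on [w], [beta * nu = theta / q],
    so that [eps^(beta * alpha)] is negligible with respect to [eps^(theta / q)]. *)
Lemma exponent_obstruction (theta q alpha C : R) (r : \bar R) (w : R -> \bar R) :
  0 < theta -> 1 <= q -> (1 <= r)%E -> nu theta q r < alpha ->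
  (forall eps : R, 0 <= eps <= 1 -> (0 <= w eps <= (match r with
     | EFin r0 => eps `^ ((r0 + theta) / r0)
     | _ => eps end)%:E)%E) ->
  exists eps : R, 0 <= eps <= 1 /\
    (C%:E * w eps `^ alpha < (8^-1 * eps `^ (theta / q))%:E)%E.
Proof.
move=> t0 q1 r1 nua hw.
have q0 : 0 < q by rewrite (lt_le_trans ltr01).
pose beta := match r with EFin r0 => (r0 + theta) / r0 | _ => 1 end.
have [beta0 betanu] : 0 < beta /\ beta * nu theta q r = theta / q.
  rewrite /beta /nu; case: r r1 {nua hw beta} => [r0| |] // r1.
    have r0_gt0 : 0 < r0 by rewrite (lt_le_trans ltr01)// -lee_fin.
    have rt : 0 < r0 + theta by rewrite addr_gt0.
    by split; [rewrite divr_gt0|field; rewrite !gt_eqF].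
  by rewrite mul1r.
have nu0 : 0 <= nu theta q r by rewrite -(pmulr_rge0 _ beta0) betanu divr_ge0 ?ltW.
have alpha0 : 0 < alpha := le_lt_trans nu0 nua.
pose delta := beta * alpha - theta / q.
have delta0 : 0 < delta by rewrite subr_gt0 -betanu ltr_pM2l.
pose K := Num.max C 1.
have K1 : 1 <= K by rewrite le_max lexx orbT.
have K0 : 0 < K by rewrite (lt_le_trans ltr01).
have CK : C <= K by rewrite le_max lexx.
(* [eps] is chosen so that [K * eps^delta = 1/16], half of [1/8]. *)
pose a := (16 * K)^-1.
have a0 : 0 < a by rewrite invr_gt0 mulr_gt0.
have a1 : a <= 1 by rewrite invf_le1 ?mulr_gt0//; lra.
pose eps := a `^ delta^-1.
have eps0 : 0 < eps by exact: powR_gt0.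
have eps1 : eps <= 1.
  have <- : 1 `^ delta^-1 = 1 :> R by rewrite powR1.
  apply: ge0_ler_powR => //; last by rewrite nnegrE.
    by rewrite invr_ge0 ltW.
  by rewrite nnegrE ltW.
have he : 0 <= eps <= 1 by apply/andP; split=> //; exact: ltW.
exists eps; split=> //.
have /andP[w0 wle] := hw _ he.
have wle' : (w eps <= (eps `^ beta)%:E)%E.
  move: wle; rewrite /beta; case: (r) => // [] //; by rewrite powRr1// ltW.
apply: (@le_lt_trans _ _ (K%:E * (eps `^ beta)%:E `^ alpha)%E).
  apply: (@le_trans _ _ (K%:E * w eps `^ alpha)%E).
    by apply: lee_wpmul2r; [exact: poweR_ge0|rewrite lee_fin].
  apply: lee_wpmul2l; first by rewrite lee_fin ltW.
  by apply: gt0_ler_poweR;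
    rewrite ?in_itv/= ?leey ?andbT ?w0 ?lee_fin ?powR_ge0 ?(ltW alpha0).
rewrite poweR_EFin -EFinM lte_fin -powRrM.
have -> : beta * alpha = delta + theta / q by rewrite /delta subrK.
rewrite powRD; last by rewrite (gt_eqF eps0) implybT.
rewrite mulrA ltr_pM2r ?powR_gt0// /eps -powRrM mulVf ?gt_eqF// powRr1; last exact: ltW.
rewrite /a invfM mulrCA mulfV ?gt_eqF// mulr1; lra.
Qed.
End exponent_obstruction.

(** * The potential [|x_0|] *)

Section absolute_first_coordinate.
Context {R : realType} {n : nat}.
Definition e0 : 'rV[R]_n.+2 := delta_mx 0 ord0.

Lemma e00 : e0 0 ord0 = 1. Proof. by rewrite mxE !eqxx. Qed.

Lemma e0_neq i : i != ord0 -> e0 0 i = 0.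
Proof. by move=> /negbTE i0; rewrite mxE i0 andbF. Qed.

Lemma dotp_e0 (x : 'rV[R]_n.+2) : dotp e0 x = x 0 ord0.
Proof.
rewrite /dotp (bigD1 ord0)//= e00 mul1r big1 ?addr0// => i i0.
by rewrite e0_neq// mul0r.
Qed.

(** The difference of the squared distances from [x] to the two targets is linear,
    so that the sign of the first coordinate decides which of them is closer. *)
Lemma dotp_add_e0 (x : 'rV[R]_n.+2) :
  dotp (x + e0) (x + e0) = dotp (x - e0) (x - e0) + 4 * x 0 ord0.
Proof.
rewrite /dotp (bigD1 ord0)//= [in RHS](bigD1 ord0)//= !mxE !eqxx/=.
rewrite [X in _ + X = _](eq_bigr (fun i => (x - e0) 0 i * (x - e0) 0 i)) => [|i i0].
  ring.
by rewrite !mxE (negbTE i0) andbF !addr0 subr0.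
Qed.

Definition abs0 (x : 'rV[R]_n.+2) : R := `|x 0 ord0|.

Lemma gradient_abs0 (x : 'rV[R]_n.+2) : 0 < x 0 ord0 -> gradient abs0 x = e0.
Proof.
move=> x0; apply/rowP => i; rewrite !mxE /derive.
apply: (@lim_near_cst R).
  exact: (@norm_hausdorff _ R).
near=> h.
have h0 : h != 0 by near: h; exact: nbhs_dnbhs_neq.
have hx : `|h| < x 0 ord0.
  near: h; exact: dnbhs0_lt.
rewrite /abs0/= !mxE/= (gtr0_norm x0).
rewrite [ord0 == i]eq_sym; case: (i == ord0); last first.
  by rewrite mulr0 add0r gtr0_norm// subrr scaler0.
rewrite mulr1 ger0_norm ?addrK ?[_ *: _]mulVf//.
by move: hx; rewrite ltr_norml => /andP[? _]; lra.
Unshelve. all: by end_near. Qed.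

Lemma convex_abs0 : convex_function [set: 'rV[R]_n.+2] abs0.
Proof.
move=> t x y _ _; rewrite convRE /abs0 !mxE/=.
apply: (le_trans (ler_normD _ _)); rewrite !normrM.
have t1 : 0 <= unstable.onem t%:num by rewrite subr_ge0.
by rewrite (ger0_norm t1) (@ger0_norm _ t%:num).
Qed.

(** [abs0] is [1]-Lipschitz along each coordinate axis, so the coordinates of a
    subgradient are at most [1] in absolute value. *)
Lemma subdiff_abs0_cube : \bigcup_x subdiff abs0 x `<=` cube R n.+2.
Proof.
move=> y [x _ yx] i; rewrite /=.
have dotd (t : R) : dotp y (x + t *: delta_mx 0 i - x) = t * y 0 i.
  rewrite addrC addKr /dotp (bigD1 i)//= !mxE !eqxx mulr1 mulrC big1 ?addr0// => j ji.
  by rewrite !mxE (negbTE ji) andbF !mulr0.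
have abs_t (t : R) : abs0 (x + t *: delta_mx 0 i) <= abs0 x + `|t|.
  rewrite /abs0 !mxE/=; apply: (le_trans (ler_normD _ _)); rewrite lerD2l normrM.
  by rewrite ler_piMr//; case: (_ == _); rewrite ?normr0 ?normr1.
have := yx (x + 1 *: delta_mx 0 i); have := yx (x + (-1) *: delta_mx 0 i).
rewrite !dotd => h1 h2.
have := le_trans h1 (abs_t _); have := le_trans h2 (abs_t _).
rewrite normrN normr1 => ? ?; apply/andP; split; lra.
Qed.

Lemma subdiff_abs0_e0 (x : 'rV[R]_n.+2) : 0 <= x 0 ord0 -> subdiff abs0 x e0.
Proof.
move=> x0 z; rewrite dotp_e0 !mxE /abs0 ger0_norm//.
by rewrite subrKC ler_norm.
Qed.

Lemma subdiff_abs0_oppe0 (x : 'rV[R]_n.+2) : x 0 ord0 = 0 -> subdiff abs0 x (- e0).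
Proof.
move=> x0 z.
have -> : dotp (- e0) (z - x) = - dotp e0 (z - x).
  by rewrite /dotp -sumrN; apply: eq_bigr => i _; rewrite mxE mulNr.
rewrite dotp_e0 !mxE /abs0 x0 normr0 add0r subr0 -normrN; exact: ler_norm.
Qed.

(** Each point off the graph violates a subgradient inequality, which is an open
    condition disjoint from the graph. *)
Lemma spt_sub_graph (g : probability (Rd R n.+2 * Rd R n.+2)%type R) :
  (forall A : set (Rd R n.+2 * Rd R n.+2),
    A `&` graph_subdiff abs0 = set0 -> g A = 0%E) ->
  spt g `<=` graph_subdiff abs0.
Proof.
move=> gA z zg y; rewrite leNgt; apply/negP => yz.
pose f (u : 'rV[R]_n.+2 * 'rV[R]_n.+2) : R := abs0 u.1 + dotp u.2 (y - u.1).
have cc (i : 'I_n.+2) (u : 'rV[R]_n.+2 * 'rV[R]_n.+2) :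
    {for u, continuous (fun v : 'rV[R]_n.+2 * 'rV[R]_n.+2 => v.1 0 i : R)} /\
    {for u, continuous (fun v : 'rV[R]_n.+2 * 'rV[R]_n.+2 => v.2 0 i : R)}.
  split; [apply: (@continuous_comp _ _ _ fst (fun M : 'rV[R]_n.+2 => M 0 i))
         |apply: (@continuous_comp _ _ _ snd (fun M : 'rV[R]_n.+2 => M 0 i))].
  - exact: cvg_fst.
  - exact: coord_continuous.
  - exact: cvg_snd.
  - exact: coord_continuous.
have cf : continuous f.
  move=> u; apply: cvgD.
    by apply: cvg_norm; exact: (cc ord0 u).1.
  apply: cvg_big; first exact: add_continuous.
  move=> i _; apply: cvgM; first exact: (cc i u).2.
  under eq_cvg do rewrite !mxE; rewrite !mxE.
  by apply: cvgB; [exact: cvg_cst|exact: (cc i u).1].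
have oU : open (f @^-1` [set t | abs0 y < t]).
  apply: open_comp; last exact: open_gt.
  by move=> u _; exact: cf.
have := zg _ oU yz; rewrite gA ?ltxx//.
apply/seteqP; split => // u [/= + /(_ y)]; rewrite /f ltNge.
by move=> /negP.
Qed.

Lemma compact_cube d : compact (cube R d : set 'rV[R]_d).
Proof.
have := @rV_compact R d (fun=> `[-1, 1]%classic) (fun=> @segment_compact R _ _).
by congr compact; apply/seteqP; split => x /= h i; have := h i; rewrite in_itv.
Qed.

Lemma convex_cube d : convex_set (cube R d : set 'rV[R]_d).
Proof.
move=> x y t; rewrite !inE => hx hy i; rewrite !mxE/=.
have /andP[x1 x2] := hx i; have /andP[y1 y2] := hy i.
have t0 : 0 <= t%:num by [].
have t1 : t%:num <= 1 by [].
by rewrite /unstable.onem; apply/andP; split; nra.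
Qed.
End absolute_first_coordinate.

(** * The collapsed slab *)

Section collapsed_model.
Context {R : realType} {n : nat} {theta : R}.
Context {P : probability (Rd R n.+2) R} {X : Rd R n.+2 -> Rd R n.+2}.
Hypothesis htheta : 0 < theta <= 1.
Hypothesis mX : measurable_fun setT X.

Local Notation e0 := (@e0 R n).

Let x0 w : R := (X w : 'rV[R]_n.+2) 0 ord0.
Let x1 w : R := (X w : 'rV[R]_n.+2) 0 (lift ord0 ord0).

Hypothesis X_le1 : forall w i, `|(X w : 'rV[R]_n.+2) 0 i| <= 1.
Hypothesis x0_gt0 : forall w, 0 < x0 w.
Hypothesis x1_ge : forall w, 2^-1 <= `|x1 w|.
Let half_slab eps (s : bool) : set (Rd R n.+2) :=
  [set w | x0 w < eps /\ (if s then 0 < x1 w else x1 w < 0)].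

Hypothesis mass_half_slab : forall (eps : R) (s : bool), 0 <= eps <= 1 ->
  P (half_slab eps s) = (eps `^ theta / 2)%:E.

Definition collapse (eps : R) (w : Rd R n.+2) : Rd R n.+2 :=
  \row_i if (i == ord0) && (x0 w < eps) then 0 else (X w : 'rV[R]_n.+2) 0 i.

Definition target (eps : R) (s : bool) (w : Rd R n.+2) : Rd R n.+2 :=
  if (x0 w < eps) && (if s then 0 < x1 w else x1 w < 0) then - e0 else e0.

Lemma measurable_x0 : measurable_fun setT x0.
Proof. exact: measurable_coord_comp. Qed.

Lemma measurable_x1 : measurable_fun setT x1.
Proof. exact: measurable_coord_comp. Qed.

Lemma measurable_fun_x0_lt (eps : R) : measurable_fun setT (fun w => x0 w < eps).
Proof. by apply: measurable_fun_ltr => //; exact: measurable_x0. Qed.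

Lemma measurable_collapse (eps : R) : measurable_fun setT (collapse eps).
Proof.
apply: measurable_to_Rd => i; under eq_fun do rewrite mxE.
apply: measurable_fun_ifT => //; last exact: measurable_coord_comp.
by apply: measurable_and => //; exact: measurable_fun_x0_lt.
Qed.

Lemma measurable_target (eps : R) s : measurable_fun setT (target eps s).
Proof.
apply: measurable_fun_ifT => //; apply: measurable_and.
  exact: measurable_fun_x0_lt.
by case: s; apply: measurable_fun_ltr => //; exact: measurable_x1.
Qed.

Lemma measurable_x0_lt (eps : R) : measurable [set w | x0 w < eps].
Proof. by have [] := measurable_threshold eps measurable_x0. Qed.

Lemma measurable_half_slab (eps : R) (s : bool) : measurable (half_slab eps s).
Proof.
apply: measurableI; first exact: measurable_x0_lt.
by have [? _ ? _] := measurable_threshold 0 measurable_x1; case: s.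
Qed.

Lemma collapse_coord0 (eps : R) w : 0 <= (collapse eps w : 'rV[R]_n.+2) 0 ord0.
Proof. by rewrite mxE; case: ifP => // _; exact: ltW (x0_gt0 w). Qed.

Lemma collapse_coord1 (eps : R) w :
  (collapse eps w : 'rV[R]_n.+2) 0 (lift ord0 ord0) = x1 w.
Proof. by rewrite mxE. Qed.

Lemma collapse_far (eps : R) w : eps <= x0 w -> collapse eps w = X w.
Proof. by move=> h; apply/rowP => i; rewrite mxE ltNge h andbF. Qed.

Lemma collapse_le1 (eps : R) w i : `|(collapse eps w : 'rV[R]_n.+2) 0 i| <= 1.
Proof. by rewrite mxE; case: ifP => // _; rewrite normr0. Qed.

Lemma target_le1 (eps : R) s w i : `|(target eps s w : 'rV[R]_n.+2) 0 i| <= 1.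
Proof.
have e0_le1 : `|e0 0 i| <= 1.
  have [->|/e0_neq->] := eqVneq i ord0; first by rewrite e00 normr1.
  by rewrite normr0.
by rewrite /target; case: ifP => _ //; rewrite mxE normrN.
Qed.

Lemma enorm_collapse (eps : R) w : 0 <= eps ->
  enorm (collapse eps w - X w : 'rV[R]_n.+2) <= eps.
Proof.
move=> eps0; have [h|h] := leP eps (x0 w).
  rewrite collapse_far// subrr /enorm /dotp big1 ?sqrtr0// => i _.
  by rewrite mxE mul0r.
rewrite /enorm /dotp (bigD1 ord0)//= big1 ?addr0 => [|i i0].
  rewrite !mxE eqxx h/= sub0r mulrNN -expr2 sqrtr_sqr.
  by rewrite ger0_norm ltW// x0_gt0.
by rewrite !mxE (negbTE i0)/= subrr mul0r.
Qed.

Lemma mass_x0_lt (eps : R) : 0 <= eps <= 1 ->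
  (P [set w | (x0 w < eps)%R] <= (eps `^ theta)%:E)%E.
Proof.
move=> he.
have -> : (eps `^ theta)%:E =
    ((eps `^ theta / 2)%:E + (eps `^ theta / 2)%:E)%E :> \bar R.
  by rewrite -EFinD; congr (_%:E); lra.
rewrite -{1}(mass_half_slab true he) -(mass_half_slab false he).
apply: (@le_trans _ _ (P (half_slab eps true `|` half_slab eps false))); last first.
  by apply: measureU2; exact: measurable_half_slab.
apply: le_measure; rewrite ?inE//.
- exact: measurable_x0_lt.
- by apply: measurableU; exact: measurable_half_slab.
move=> w /= x0w; have := x1_ge w; have [x1w|x1w] := ltP 0 (x1 w).
  by left.
by rewrite ler0_norm// => h; right; split => //; lra.
Qed.

(** Both orders occur: one estimate measures the distance from the perturbed law to
    the reference law, the other one the reverse distance. *)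
Lemma W_collapse (eps : R) (r : \bar R) (rho rho' : probability (Rd R n.+2) R) :
  0 <= eps <= 1 -> (1 <= r)%E ->
  (rho, rho') = (law P (measurable_collapse eps), law P mX) \/
  (rho, rho') = (law P mX, law P (measurable_collapse eps)) ->
  (W r rho rho' <= (match r with
     | EFin r0 => eps `^ ((r0 + theta) / r0)
     | _ => eps end)%:E)%E.
Proof.
move=> /[dup] he /andP[eps0 eps1] r1 rr.
have /andP[t0 t1] := htheta.
have -> : (match r with EFin r0 => eps `^ ((r0 + theta) / r0) | _ => eps end =
    match r with EFin r0 => (eps `^ r0 * eps `^ theta) `^ r0^-1 | _ => eps end :> R).
  case: r r1 {rr} => // r0 r1; rewrite lee_fin in r1.
  by rewrite -powRD ?powRrM//; apply/implyP => /eqP; lra.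
have mN := measurable_x0_lt eps.
case: rr => -[-> ->]; apply: (W_law_le _ _ mN eps0 (mass_x0_lt he) r1) => w.
- exact: enorm_collapse.
- by move=> /= /negP; rewrite -leNgt => /collapse_far.
- by rewrite enorm_distC; exact: enorm_collapse.
- by move=> /= /negP; rewrite -leNgt => /collapse_far.
Qed.

(** The two target maps take the value [- e0] on events of equal mass, so the plans
    built from them have the same second marginal. *)
Lemma is_pushforward_target (eps : R) s s' : 0 <= eps <= 1 ->
  is_pushforward (target eps s) P (law P (measurable_target eps s')).
Proof.
move=> he A mA; rewrite /pushforward lawE.
(* The law of a two-valued map is determined by the mass of one of its values. *)
have key t : P (target eps t @^-1` A) =
    (if pselect (A e0) then
       if pselect (A (- e0)%R) then 1 else 1 - (eps `^ theta / 2)%:E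
     else if pselect (A (- e0)%R) then (eps `^ theta / 2)%:E else 0)%E.
  rewrite -(mass_half_slab t he).
  set E := half_slab eps t.
  have tE w : target eps t w = if w \in E then - e0 else e0.
    rewrite /target /E /half_slab; congr (if _ then _ else _).
    by apply/idP/idP; [move=> /andP[? ?]; rewrite inE|rewrite inE => -[-> ->]].
  case: pselect => Ae /=; case: pselect => Ane /=.
  - rewrite -(probability_setT P); congr (P _); apply/seteqP; split => // w _.
    by rewrite /= tE; case: ifP.
  - rewrite -probability_setC; last exact: measurable_half_slab.
    congr (P _); apply/seteqP; split => w /=; rewrite tE; case: ifPn => //.
      by rewrite notin_setE.
    by move=> /set_mem Ew /(_ Ew).
  - congr (P _); apply/seteqP; split => w /=; rewrite tE; case: ifPn => //.
      by move=> /set_mem.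
    by rewrite notin_setE.
  - rewrite -(measure0 P); congr (P _); apply/seteqP; split => w //=; rewrite tE.
    by case: ifP.
by rewrite !key.
Qed.

Lemma collapse_target_optimal (eps : R) s s' : 0 <= eps <= 1 ->
  optimal_plans (law P (measurable_collapse eps)) (law P (measurable_target eps s'))
    (law P (measurable_fun_pair (measurable_collapse eps) (measurable_target eps s))).
Proof.
move=> he.
apply: (@optimal_plans_law _ _ _ _ _ _ _ _ _ _
  [set x : 'rV[R]_n.+2 | 0 <= x 0 ord0] [set y : 'rV[R]_n.+2 | y = e0 \/ y = - e0] e0).
- exact: is_pushforward_target.
- by have [_ _ _] := measurable_threshold 0 (@measurable_coord R n.+2 ord0); exact.
- rewrite (_ : [set _ | _] = [set e0] `|` [set - e0])//.
  have c1 (y : 'rV[R]_n.+2) : measurable ([set y] : set (Rd R n.+2)).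
    apply: closed_measurable_Rd; apply: accessible_closed_set1.
    exact: hausdorff_accessible (@norm_hausdorff _ _).
  by apply: measurableU; exact: c1.
- exact: collapse_coord0.
- by move=> w /=; rewrite /target; case: ifP => _; [right|left].
- move=> x y /= x_ge0 [->//|->]; rewrite opprK; apply: ler_wsqrtr.
  by rewrite dotp_add_e0 lerDl mulr_ge0.
- move=> w; rewrite /target; case: ifP => // /andP[x0w _].
  rewrite /enorm opprK dotp_add_e0 !mxE eqxx/=.
  by rewrite -/(x0 w) x0w mulr0 addr0.
Qed.

Lemma collapse_target_subdiff (eps : R) (s : bool) w :
  subdiff abs0 (collapse eps w) (target eps s w).
Proof.
rewrite /target; case: ifP => [/andP[x0w _]|_].
  by apply: subdiff_abs0_oppe0; rewrite mxE x0w.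
by apply: subdiff_abs0_e0; exact: collapse_coord0.
Qed.

(** Stated for a general first plan, so that it applies both to the two optimal
    plans and to the graph of a gradient.  With [A] the points with [x_1 >= 1/2]
    and target [e0], and [B] the points with [x_1 <= -1/2] or target [- e0], the half
    slab [x_1 > 0] is the excess mass that travels from [A] to [B]. *)
Lemma Wplan_collapse_ge (eps : R) (q : R) (X' Y' : Rd R n.+2 -> Rd R n.+2)
    (mX' : measurable_fun setT X') (mY' : measurable_fun setT Y') :
  1 <= q -> 0 <= eps <= 1 ->
  (forall w, (X' w : 'rV[R]_n.+2) 0 (lift ord0 ord0) = x1 w) ->
  (forall w, 0 < x1 w -> Y' w = e0) ->
  ((8^-1 * eps `^ (theta / q))%:E <=
   Wplan q (law P (measurable_fun_pair mX' mY'))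
     (law P (measurable_fun_pair (measurable_collapse eps)
                                 (measurable_target eps true))))%E.
Proof.
move=> q1 /[dup] he /andP[eps0 eps1] X'1 Y'e.
have q0 : 0 < q by rewrite (lt_le_trans ltr01).
pose c1 (z : Rd R n.+2 * Rd R n.+2) := (z.1 : 'rV[R]_n.+2) 0 (lift ord0 ord0).
pose c2 (z : Rd R n.+2 * Rd R n.+2) := (z.2 : 'rV[R]_n.+2) 0 ord0.
have mc1 : measurable_fun setT c1 by apply: measurable_coord_comp.
have mc2 : measurable_fun setT c2 by apply: measurable_coord_comp.
pose A := [set z | 2^-1 <= c1 z] `&` [set z | 1 <= c2 z].
pose B := [set z | c1 z <= - 2^-1] `|` [set z | c2 z <= -1].
apply: le_trans (@Wplan_law_ge _ _ _ _ _ _ _ _ _ A B _ q _ _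
  (measurable_half_slab eps true) q0 _ _ _).
- rewrite mass_half_slab// poweR_EFin lee_fin powRM ?powR_ge0//.
  rewrite mulrC powRrM ler_wpM2l ?powR_ge0//.
  apply: (@le_trans _ _ 2^-1); first lra.
  by apply: ger1_powR; [lra|rewrite invf_le1].
- have [_ _ _ m1] := measurable_threshold 2^-1 mc1.
  by have [_ _ _ m2] := measurable_threshold 1 mc2; exact: measurableI.
- have [_ m1 _ _] := measurable_threshold (- 2^-1) mc1.
  by have [_ m2 _ _] := measurable_threshold (-1) mc2; exact: measurableU.
- move=> w /not_orP[]; rewrite /c1 /= collapse_coord1 => /negP; rewrite -ltNge => h _.
  have x1w : 0 < x1 w.
    rewrite ltNge; apply/negP => h'; have := x1_ge w.
    by rewrite ler0_norm// => ?; lra.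
  split; rewrite /c1 /c2 /=; last by rewrite Y'e// e00.
  by rewrite X'1; have := x1_ge w; rewrite gtr0_norm.
- move=> w /= [x0w x1w]; split.
    split; rewrite /c1 /c2 /=; last by rewrite Y'e// e00.
    by rewrite X'1; have := x1_ge w; rewrite gtr0_norm.
  by right; rewrite /c2/= /target x0w x1w/= mxE e00.
- move=> x y [Ax1 Ax2] [By|By].
    left; apply: le_trans (coord_le_enorm _ (lift ord0 ord0)).
    rewrite !mxE; move: Ax1 By; rewrite /c1 /= => ? ?.
    rewrite ger0_norm; lra.
  right; apply: le_trans (coord_le_enorm _ ord0).
  rewrite !mxE; move: Ax2 By; rewrite /c2 /= => ? ?.
  rewrite ger0_norm; lra.
Qed.

Lemma diam_collapse_ge (eps : R) (q : R) : 1 <= q -> 0 <= eps <= 1 ->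
  ((8^-1 * eps `^ (theta / q))%:E <= diam_Wplan q
    (optimal_plans (law P (measurable_collapse eps))
                   (law P (measurable_target eps true))))%E.
Proof.
move=> q1 he; apply: le_ereal_sup_tmp; eexists; last first.
  apply: (Wplan_collapse_ge (measurable_collapse eps)
    (measurable_target eps false) q1 he).
  - exact: collapse_coord1.
  - by move=> w x1w; rewrite /target /= (ltNge (x1 w)) (ltW x1w) andbF.
exists (law P (measurable_fun_pair (measurable_collapse eps)
                                   (measurable_target eps false)),
        law P (measurable_fun_pair (measurable_collapse eps)
                                   (measurable_target eps true))) => //.
by split; exact: collapse_target_optimal.
Qed.

End collapsed_model.

(** * Lower bound for the diameter and optimality of the exponents *)

Unset Implicit Arguments.
Unset Printing Implicit Defensive.
Set Strict Implicit.

Theorem proposition5p1 (R : realType) (d : nat) (theta : R)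
    (hd : (2 <= d)%N) (htheta0 : 0 < theta) (htheta1 : theta <= 1) :
  (exists (rhot : probability (Rd R d) R)
          (rho mu : R -> probability (Rd R d) R),
     [/\ probas_on R (cube R d) rhot,
         exists M : R, 0 < M /\ ball_growth M (d%:R - 1 + theta) rhot,
         forall eps : R, 0 <= eps <= 1 ->
           probas_on R (cube R d) (rho eps) /\ probas_on R (cube R d) (mu eps)
       & forall (q : R) (r : \bar R) (eps : R),
           1 <= q -> (1 <= r)%E -> 0 <= eps <= 1 ->
           ((8^-1 * eps `^ (theta / q))%:E
              <= diam_Wplan q (optimal_plans (rho eps) (mu eps)))%E /\
           (W r (rho eps) rhot
              <= (match r with
                  | EFin r0 => eps `^ ((r0 + theta) / r0)
                  | _ => eps
                  end)%:E)%E])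
  /\
  (forall (q : R) (r : \bar R) (alpha : R),
     1 <= q -> (1 <= r)%E -> nu theta q r < alpha ->
     ~ (forall (X Y : set 'rV[R]_d) (M : R) (rhobar : probability (Rd R d) R),
          compact X -> convex_set X -> compact Y -> convex_set Y ->
          0 < M -> probas_on R (X : set (Rd R d)) rhobar ->
          ball_growth M (d%:R - 1 + theta) rhobar ->
          exists C : R, plans_estimate q r alpha X Y rhobar C)
     /\
     ~ (forall (X Y : set 'rV[R]_d) (M : R) (rhobar : probability (Rd R d) R),
          compact X -> convex_set X -> compact Y -> convex_set Y ->
          0 < M -> probas_on R (X : set (Rd R d)) rhobar ->
          ball_growth M (d%:R - 1 + theta) rhobar ->
          exists C : R, maps_estimate q r alpha X Y rhobar C)).
Proof.
case: d hd => [|[|n]] // _.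
have htheta : 0 < theta <= 1 by rewrite htheta0.
have [P [X [mX [X_le1 x0_gt0 x1_ge [M [M0 growth]] mass_half_slab]]]] :=
  @model_exists R theta n htheta.
pose rho eps := law P (measurable_collapse mX eps).
pose mu eps := law P (measurable_target mX eps true).
have cubeP (Y : Rd R n.+2 -> Rd R n.+2) (mY : measurable_fun setT Y) :
    (forall w i, `|(Y w : 'rV[R]_n.+2) 0 i| <= 1) ->
    probas_on R (cube R n.+2) (law P mY).
  move=> Y1; rewrite /probas_on /= -(probability_setT P).
  rewrite -[LHS]/(P (Y @^-1` cube R n.+2)).
  by congr (P _); apply/seteqP; split => // w _ i; rewrite -ler_norml.
have rhoP eps := cubeP _ (measurable_collapse mX eps) (collapse_le1 X_le1 eps).
have muP eps := cubeP _ (measurable_target mX eps true) (target_le1 eps true).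
have rhotP := cubeP _ mX X_le1.
split.
  exists (law P mX), rho, mu; split=> //.
  - by exists M.
  - by move=> eps _; split; [exact: rhoP|exact: muP].
  - move=> q r eps q1 r1 he; split.
      exact: (diam_collapse_ge mX x0_gt0 x1_ge mass_half_slab).
    by apply: (W_collapse htheta x0_gt0 x1_ge mass_half_slab) => //; left.
move=> q r alpha q1 r1 nua.
have hcube := @compact_cube R n.+2.
have ccube := @convex_cube R n.+2.
split=> /(_ _ _ M (law P mX) hcube ccube hcube ccube M0 rhotP growth) [C].
- move=> est.
  have [|eps [he]] := @exponent_obstruction R theta q alpha C r
    (fun eps => W r (rho eps) (law P mX)) htheta0 q1 r1 nua.
    move=> eps he; rewrite W_ge0/=.
    by apply: (W_collapse htheta x0_gt0 x1_ge mass_half_slab) => //; left.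
  rewrite ltNge => /negP; apply.
  apply: le_trans (est (rho eps) (mu eps) (rhoP eps) (muP eps)).
  exact: (diam_collapse_ge mX x0_gt0 x1_ge mass_half_slab).
- move=> est.
  have [|eps [he]] := @exponent_obstruction R theta q alpha C r
    (fun eps => W r (law P mX) (rho eps)) htheta0 q1 r1 nua.
    move=> eps he; rewrite W_ge0/=.
    by apply: (W_collapse htheta x0_gt0 x1_ge mass_half_slab) => //; right.
  rewrite ltNge => /negP; apply.
  have me0 : measurable_fun setT (cst (e0 : Rd R n.+2) : Rd R n.+2 -> Rd R n.+2).
    exact: measurable_cst.
  pose g0 := law P (measurable_fun_pair mX me0).
  pose g1 := law P (measurable_fun_pair (measurable_collapse mX eps)
                                        (measurable_target mX eps true)).
  apply: (@le_trans _ _ (Wplan q g0 g1)).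
    by apply: (Wplan_collapse_ge mX x1_ge mass_half_slab).
  apply: (est abs0 g0 g1 (rho eps)).
  + exact: convex_abs0.
  + exact: subdiff_abs0_cube.
  + move=> A mA; rewrite -[LHS]/(P _) -[RHS]/(P _); congr (P _).
    by apply/seteqP; split => w /=; rewrite gradient_abs0.
  + rewrite /probas_on /= -(probability_setT P) -[LHS]/(P _); congr (P _).
    by apply/seteqP; split => // w _; split => i;
      rewrite -ler_norml ?collapse_le1 ?target_le1.
  + by [].
  + apply: spt_sub_graph => A Agraph.
    rewrite -[LHS]/(P _) -(measure0 P); congr (P _); apply/seteqP; split => // w Aw.
    suff : set0 (@collapse R n X eps w, @target R n X eps true w) by [].
    rewrite -Agraph; split; first exact: Aw.
    exact: (collapse_target_subdiff x0_gt0).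
Qed.
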